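(* Let $a,b\ge1$, $P=[a]\times[b]$, $n=a+b$. Let $F:\mathcal O(P)\to\mathbb R$ be of the form $F(f)=\sum_{(i,j)\in P}c_{i,j}f(i,j)$ for real constants $c_{i,j}$, and suppose $F$ is homomesic under $\rho_{\mathcal P}$ (equivalently, under $\pi_{\mathcal P}$), i.e. $\frac1n\sum_{m=0}^{n-1}F(\rho_{\mathcal P}^m(f))$ is the same for all $f\in\mathcal O(P)$. Then $F$ is a linear combination of the functionals $F_{i,j}(f)=f(i,j)+f(a+1-i,b+1-j)$ ($1\le i\le a$, $1\le j\le b$) and $F_k(f)=\sum_{(i,j)\in P:\,j-i=k-a}f(i,j)$ ($1\le k\le n-1$).
   Context: $[a]\times[b]=\{(i,j)\in\mathbb Z^2:1\le i\le a,\ 1\le j\le b\}$ with the product order. Let $\widehat P=P\cup\{\hat0,\hat1\}$ with $\hat0<x<\hat1$ for all $x\in P$; write $y\lessdot x$ for covering relations. The order polytope $\mathcal O(P)$ is the set of order-preserving maps $f:P\to[0,1]$, extended by $\hat f(\hat0)=0$, $\hat f(\hat1)=1$. The piecewise-linear toggle $\tau_x$ ($x\in P$) changes only the value at $x$: $(\tau_xf)(x)=\max\{\hat f(y):y\in\widehat P,\ y\lessdot x\}+\min\{\hat f(y):y\in\widehat P,\ y\gtrdot x\}-f(x)$. Piecewise-linear rowmotion $\rho_{\mathcal P}=\tau_{x_1}\circ\cdots\circ\tau_{x_p}$ for any linear extension $x_1,\dots,x_p$ of $P$. The $k$-th file is $\{(i,j)\in P:j-i+a=k\}$; $\tau^*_k$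 is the composition of the toggles over file $k$; piecewise-linear promotion $\pi_{\mathcal P}=\tau^*_{n-1}\circ\cdots\circ\tau^*_1$. Both maps satisfy $T^n=\mathrm{id}$ on $\mathcal O(P)$. *)

(* Defs.v *)
From Stdlib Require Import Reals List Arith Bool.
Import ListNotations.
Open Scope R_scope.

(* A labelling of P = [a] x [b] is a function f : nat -> nat -> R; only the
   values f i j with 1 <= i <= a, 1 <= j <= b are meaningful. *)
Definition lab := nat -> nat -> R.

(* The elements of P, listed row-major: (1,1),(1,2),...,(1,b),(2,1),...
   This is a linear extension of the product order. *)
Definition elemsP (a b : nat) : list (nat * nat) :=
  list_prod (seq 1 a) (seq 1 b).

Definition inP (a b i j : nat) : Prop :=
  (1 <= i <= a)%nat /\ (1 <= j <= b)%nat.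

Definition in_OP (a b : nat) (f : lab) : Prop :=
  (forall i j, inP a b i j -> 0 <= f i j <= 1) /\
  (forall i j i' j', inP a b i j -> inP a b i' j' ->
     (i <= i')%nat -> (j <= j')%nat -> f i j <= f i' j').

(* max of fhat over lower covers of (i,j) in Phat (0hat has value 0). *)
Definition lowmax (f : lab) (i j : nat) : R :=
  if (i =? 1)%nat then
    (if (j =? 1)%nat then 0 else f 1%nat (j - 1)%nat)
  else if (j =? 1)%nat then f (i - 1)%nat 1%nat
  else Rmax (f (i - 1)%nat j) (f i (j - 1)%nat).

(* min of fhat over upper covers of (i,j) in Phat (1hat has value 1). *)
Definition upmin (a b : nat) (f : lab) (i j : nat) : R :=
  if (i =? a)%nat then
    (if (j =? b)%nat then 1 else f a (j + 1)%nat)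
  else if (j =? b)%nat then f (i + 1)%nat b
  else Rmin (f (i + 1)%nat j) (f i (j + 1)%nat).

Definition toggle (a b : nat) (x : nat * nat) (f : lab) : lab :=
  fun i j =>
    if andb (i =? fst x)%nat (j =? snd x)%nat
    then lowmax f i j + upmin a b f i j - f i j
    else f i j.

Definition rowmotion (a b : nat) (f : lab) : lab :=
  fold_right (toggle a b) f (elemsP a b).

Definition sumL (l : list R) : R := fold_right Rplus 0 l.

Definition sumP (a b : nat) (g : nat -> nat -> R) : R :=
  sumL (map (fun p => g (fst p) (snd p)) (elemsP a b)).

Definition linF (a b : nat) (c : nat -> nat -> R) (f : lab) : R :=
  sumP a b (fun i j => c i j * f i j).

(* F is homomesic under rowmotion (orbit period n = a + b). *)
Definition homomesic_rowmotion (a b : nat) (F : lab -> R) : Prop :=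
  exists K : R, forall f, in_OP a b f ->
    / INR (a + b) *
      sumL (map (fun m => F (Nat.iter m (rowmotion a b) f)) (seq 0 (a + b)))
    = K.

Definition Fij (a b i j : nat) (f : lab) : R :=
  f i j + f (a + 1 - i)%nat (b + 1 - j)%nat.

(* F_k(f) = sum over (i,j) in P with j - i = k - a, i.e. j + a = k + i. *)
Definition Fk (a b k : nat) (f : lab) : R :=
  sumP a b (fun i j => if (j + a =? k + i)%nat then f i j else 0).

(* Main.v *)
(** Write [n = a + b] and let [H] be the height function of an [n]-periodic
    0/1 word with [b] ones per period.  The 0/1 labellings
    [f_m(i,j) = [H(m+n-i) - H(m+b-j) < j]] form a rowmotion orbit: after a shift
    of time depending on [j], rowmotion becomes rotation of the word.  Summed
    over a period, the contribution of [(i,j)] is the number of windows of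
    length [k = j-i+a] of the cyclic word with fewer than [j] ones.

    Choosing a word in which the factors at positions [0,1] and [q,q+1] can be
    independently [01] or [10], the mixed second difference of this count only
    sees windows with both ends at the two swapped places, i.e. [k = q] or
    [k = n-q].  Homomesy makes the second difference of the total vanish, which
    says that [c(i,j) - c(a+1-i,b+1-j)] takes the same value at [(i,j)] and
    [(i+1,j+1)].  Hence this antisymmetric part of [c] is constant on files,
    and the symmetric part is a combination of the [F_{i,j}]. *)

Require Import Defs.
From Stdlib Require Import Reals List Arith.
From Stdlib Require Import Bool Lra Lia Sorted Permutation.
Import ListNotations.
Open Scope R_scope.

(** * Finite sums *)

Lemma sumL_map_ext {A : Type} (g h : A -> R) (l : list A) :
  (forall x, In x l -> g x = h x) -> sumL (map g l) = sumL (map h l).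
Proof.
  intros E. f_equal. now apply map_ext_in.
Qed.

Lemma sumL_map_cons {A : Type} (g : A -> R) (x : A) (l : list A) :
  sumL (map g (x :: l)) = g x + sumL (map g l).
Proof. reflexivity. Qed.

Lemma sumL_map_plus {A : Type} (g h : A -> R) (l : list A) :
  sumL (map (fun x => g x + h x) l) = sumL (map g l) + sumL (map h l).
Proof.
  induction l as [|x l IH]; [cbn; lra|rewrite !sumL_map_cons, IH; lra].
Qed.

Lemma sumL_map_scal {A : Type} (r : R) (g : A -> R) (l : list A) :
  sumL (map (fun x => r * g x) l) = r * sumL (map g l).
Proof.
  induction l as [|x l IH]; [cbn; lra|rewrite !sumL_map_cons, IH; lra].
Qed.

Lemma sumL_map_zero {A : Type} (g : A -> R) (l : list A) :
  (forall x, In x l -> g x = 0) -> sumL (map g l) = 0.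
Proof.
  intros E. induction l as [|x l IH]; [easy|].
  rewrite sumL_map_cons, IH, E; [lra|now left|].
  intros y Hy. apply E. now right.
Qed.

Lemma sumL_map_single {A : Type} (g : A -> R) (l : list A) (x : A) :
  NoDup l -> In x l -> (forall y, In y l -> y <> x -> g y = 0) ->
  sumL (map g l) = g x.
Proof.
  intros N I E. induction N as [|y l Hy N IH]; [easy|].
  rewrite sumL_map_cons. destruct I as [->|I].
  - rewrite sumL_map_zero; [lra|].
    intros z Hz. apply E; [now right|]. now intros ->.
  - rewrite IH; auto.
    + rewrite E; [lra|now left|]. now intros ->.
    + intros z Hz. apply E. now right.
Qed.

Lemma sumL_map_swap {A B : Type} (g : A -> B -> R) (l : list A) (l' : list B) :
  sumL (map (fun x => sumL (map (g x) l')) l) =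
  sumL (map (fun y => sumL (map (fun x => g x y) l)) l').
Proof.
  induction l as [|x l IH].
  - symmetry. now apply sumL_map_zero.
  - rewrite sumL_map_cons, IH. now rewrite <- sumL_map_plus.
Qed.

Lemma sumL_perm (l l' : list R) : Permutation l l' -> sumL l = sumL l'.
Proof.
  unfold sumL. induction 1; cbn; lra.
Qed.

(** Moving the range by one step drops [g s] and gains [g (n + s)], which agree by periodicity. *)
Lemma sumL_seq_shift (g : nat -> R) (n s : nat) :
  (forall u, g (u + n)%nat = g u) ->
  sumL (map (fun m => g (m + s)%nat) (seq 0 n)) = sumL (map g (seq 0 n)).
Proof.
  intros P. induction s as [|s IH].
  - apply sumL_map_ext. intros; now rewrite Nat.add_0_r.
  - rewrite <- IH. clear IH.
    (* The length [k] is decoupled from the period [n], so that induction on it is possible. *)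
    assert (E : forall k : nat,
      sumL (map (fun m => g (m + S s)%nat) (seq 0 k)) + g s =
      sumL (map (fun m => g (m + s)%nat) (seq 0 k)) + g (k + s)%nat).
    { induction k as [|k IH]; [cbn; lra|].
      rewrite seq_S, !map_app. unfold sumL in *.
      rewrite !fold_right_app. cbn.
      assert (F : forall l x, fold_right Rplus x l = fold_right Rplus 0 l + x).
      { intros l x. induction l as [|y l IHl]; cbn; [|rewrite IHl]; lra. }
      rewrite (F _ (_ + 0)), (F _ (g (k + s)%nat + 0)).
      replace (k + S s)%nat with (S (k + s)) by lia. lra. }
    specialize (E n). rewrite (Nat.add_comm n s), P in E. lra.
Qed.

(** * The index list of [P] *)

Lemma in_elemsP (a b i j : nat) : In (i, j) (elemsP a b) <-> inP a b i j.
Proof.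
  unfold elemsP, inP. rewrite in_prod_iff, !in_seq. lia.
Qed.

(** The order in which [elemsP] is strictly increasing; lower covers in $P$ come earlier in the list
    and upper covers later. *)
Definition lex (x y : nat * nat) : Prop :=
  (fst x < fst y)%nat \/ fst x = fst y /\ (snd x < snd y)%nat.

Lemma StronglySorted_app_intro {A : Type} (R : A -> A -> Prop) (l l' : list A) :
  StronglySorted R l -> StronglySorted R l' ->
  (forall x y, In x l -> In y l' -> R x y) -> StronglySorted R (l ++ l').
Proof.
  intros S S' H. induction S as [|x l S IH F]; cbn; [easy|].
  constructor.
  - apply IH. intros; apply H; [now right|easy].
  - apply Forall_app. split; [easy|].
    apply Forall_forall. intros y Hy. apply H; [now left|easy].
Qed.

Lemma StronglySorted_app_elim {A : Type} (R : A -> A -> Prop) (l l' : list A) :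
  StronglySorted R (l ++ l') -> forall x y, In x l -> In y l' -> R x y.
Proof.
  induction l as [|z l IH]; cbn; [easy|].
  intros S x y [->|Hx] Hy; apply StronglySorted_inv in S; destruct S as [S F].
  - rewrite Forall_forall in F. apply F, in_app_iff. now right.
  - now apply IH.
Qed.

Lemma elemsP_sorted (a b : nat) : StronglySorted lex (elemsP a b).
Proof.
  unfold elemsP. generalize 1%nat at 1 as s.
  induction a as [|a IH]; intros s; cbn [seq list_prod]; [constructor|].
  apply StronglySorted_app_intro; [|apply IH|].
  - clear IH. generalize 1%nat as t. induction b as [|b IHb]; intros t; cbn; [constructor|].
    constructor; [apply IHb|].
    apply Forall_forall. intros y Hy. apply in_map_iff in Hy.
    destruct Hy as (v & <- & Hv). apply in_seq in Hv. right. cbn. lia.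
  - intros x [i j] Hx Hy. apply in_map_iff in Hx. destruct Hx as (v & <- & Hv).
    apply in_prod_iff in Hy. rewrite !in_seq in Hy. left. cbn. lia.
Qed.

Lemma elemsP_NoDup (a b : nat) : NoDup (elemsP a b).
Proof.
  generalize (elemsP_sorted a b).
  induction 1 as [|x l S IH F]; constructor; [|easy].
  intros I. rewrite Forall_forall in F. specialize (F x I). unfold lex in F. lia.
Qed.

Lemma sumP_ext (a b : nat) (g h : nat -> nat -> R) :
  (forall i j, inP a b i j -> g i j = h i j) -> sumP a b g = sumP a b h.
Proof.
  intros E. apply sumL_map_ext. intros [i j] I. now apply E, in_elemsP.
Qed.

Lemma sumP_plus (a b : nat) (g h : nat -> nat -> R) :
  sumP a b (fun i j => g i j + h i j) = sumP a b g + sumP a b h.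
Proof. apply sumL_map_plus. Qed.

Lemma sumP_reflect (a b : nat) (g : nat -> nat -> R) :
  sumP a b (fun i j => g (a + 1 - i)%nat (b + 1 - j)%nat) = sumP a b g.
Proof.
  unfold sumP.
  set (r := fun p : nat * nat => (a + 1 - fst p, b + 1 - snd p)%nat).
  transitivity (sumL (map (fun p => g (fst p) (snd p)) (map r (elemsP a b)))).
  { now rewrite map_map. }
  apply sumL_perm, Permutation_map, NoDup_Permutation.
  - apply NoDup_map_NoDup_ForallPairs; [|apply elemsP_NoDup].
    intros [i j] [i' j'] I I' E. apply in_elemsP in I, I'. unfold inP in *.
    injection E as E1 E2. cbn in *. f_equal; lia.
  - apply elemsP_NoDup.
  - intros [i j]. rewrite in_map_iff, in_elemsP. split.
    + intros ([i' j'] & E & I). apply in_elemsP in I. unfold inP in *.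
      injection E as E1 E2. cbn in *. lia.
    + intros I. exists (r (i, j)). unfold inP, r in *; cbn. split.
      * f_equal; lia.
      * apply in_elemsP. unfold inP. lia.
Qed.

Definition single (x y i j : nat) : R :=
  if ((i =? x)%nat && (j =? y)%nat)%bool then 1 else 0.

Lemma sumP_single (a b x y : nat) (c : nat -> nat -> R) :
  inP a b x y -> sumP a b (fun i j => c i j * single x y i j) = c x y.
Proof.
  intros I. unfold sumP.
  rewrite (sumL_map_single _ _ (x, y)); cbn.
  - unfold single. rewrite !Nat.eqb_refl. cbn. lra.
  - apply elemsP_NoDup.
  - now apply in_elemsP.
  - intros [i j] _ N. unfold single. cbn.
    destruct (Nat.eqb_spec i x), (Nat.eqb_spec j y); cbn; try lra. congruence.
Qed.

(** * Rowmotion *)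

(** [fold_right] toggles the end of the list first. When $(i,j)$ is reached, its upper covers
    already carry their new values and its lower covers still carry the old ones, so this implicit
    equation determines rowmotion from the top of $P$ down. *)
Lemma rowmotion_unique (a b : nat) (f g : lab) :
  (forall i j, inP a b i j -> g i j = lowmax f i j + upmin a b g i j - f i j) ->
  forall i j, inP a b i j -> rowmotion a b f i j = g i j.
Proof.
  intros E.
  (* Invariant: once the suffix [l2] has been toggled, its points carry [g] and all other points of
     $P$ still carry [f]. *)
  assert (Inv : forall l2 l1, elemsP a b = l1 ++ l2 -> forall i j, inP a b i j ->
    (In (i, j) l2 -> fold_right (toggle a b) f l2 i j = g i j) /\
    (~ In (i, j) l2 -> fold_right (toggle a b) f l2 i j = f i j)).
  { induction l2 as [|[x y] l2 IH]; intros l1 D i j Hij; [cbn; tauto|].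
    assert (D' : elemsP a b = (l1 ++ [(x, y)]) ++ l2) by now rewrite <- app_assoc.
    specialize (IH _ D').
    pose proof (elemsP_sorted a b) as S.
    assert (Sup : forall z, In z l2 -> lex (x, y) z).
    { rewrite D' in S. intros z Hz. eapply StronglySorted_app_elim; eauto.
      apply in_app_iff. right. now left. }
    assert (Slo : forall u v, inP a b u v -> lex (x, y) (u, v) -> In (u, v) l2).
    { intros u v I L. apply in_elemsP in I. rewrite D in I, S.
      apply in_app_iff in I. destruct I as [I|[I|I]]; [|injection I as -> ->|easy].
      - assert (L' : lex (u, v) (x, y)).
        { eapply StronglySorted_app_elim; eauto. now left. }
        unfold lex in L, L'. cbn in *. lia.
      - unfold lex in L. cbn in *. lia. }
    cbn [fold_right].
    set (F := fold_right (toggle a b) f l2) in *.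
    unfold toggle. cbn [fst snd].
    destruct (Nat.eqb_spec i x) as [Ei|Ei]; destruct (Nat.eqb_spec j y) as [Ej|Ej];
      cbn [andb];
      [|split; [intros [Q|Q]; [injection Q; intros; lia|]
               |intros Q; assert (~ In (i, j) l2) by (intros ?; apply Q; now right)];
        now apply IH ..].
    subst x y. split; [intros _|intros Q; exfalso; apply Q; now left].
    assert (Lo : forall u v, inP a b u v -> lex (u, v) (i, j) -> F u v = f u v).
    { intros u v I L. apply IH; [easy|]. intros Q. apply Sup in Q.
      unfold lex in *. cbn in *. lia. }
    assert (Up : forall u v, inP a b u v -> lex (i, j) (u, v) -> F u v = g u v).
    { intros u v I L. apply IH; [easy|]. now apply Slo. }
    assert (Hi : F i j = f i j).
    { apply IH; [easy|]. intros Q. apply Sup in Q. unfold lex in Q. cbn in Q. lia. }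
    rewrite Hi, E by easy. f_equal. f_equal.
    - unfold inP, lex in *. cbn in *. unfold lowmax.
      destruct (Nat.eqb_spec i 1), (Nat.eqb_spec j 1); [easy|..];
        rewrite ?Lo by lia; easy.
    - unfold inP, lex in *. cbn in *. unfold upmin.
      destruct (Nat.eqb_spec i a), (Nat.eqb_spec j b); [easy|..];
        rewrite ?Up by lia; easy. }
  intros i j I. apply (Inv (elemsP a b) []); [easy..|]. now apply in_elemsP.
Qed.

Lemma lowmax_ext (a b : nat) (f g : lab) :
  (forall i j, inP a b i j -> f i j = g i j) ->
  forall i j, inP a b i j -> lowmax f i j = lowmax g i j.
Proof.
  intros E i j I. unfold inP in *. unfold lowmax.
  destruct (Nat.eqb_spec i 1), (Nat.eqb_spec j 1); [easy|..];
    rewrite ?E by lia; easy.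
Qed.

(** * Rowmotion orbits from periodic words *)

Definition height (a b : nat) (H : nat -> nat) : Prop :=
  (forall t, (H t <= H (S t) <= S (H t))%nat) /\
  (forall t, (H (t + (a + b)) = H t + b)%nat).

Lemma height_lip (a b : nat) (H : nat -> nat) (s t : nat) :
  height a b H -> (s <= t -> H s <= H t <= H s + (t - s))%nat.
Proof.
  intros [St _] L. induction L as [|t L IH]; [lia|]. specialize (St t). lia.
Qed.

Definition ind (c : bool) : R := if c then 1 else 0.

(** The window from $m+b-j$ to $m+n-i$ has length $a+j-i$; the value is 1 when it holds fewer than
    $j$ ones. Adding on the right avoids a truncated difference of heights. *)
Definition orbit (a b : nat) (H : nat -> nat) (m : nat) : lab :=
  fun i j => ind (H (m + (a + b) - i) <? j + H (m + b - j))%nat.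

(** Raising $i$ shortens the window on the right. Raising $j$ by one adds one letter on the left,
    hence at most one to the count, while the threshold grows by one. *)
Lemma orbit_in_OP (a b : nat) (H : nat -> nat) (m : nat) :
  height a b H -> in_OP a b (orbit a b H m).
Proof.
  intros HH. unfold orbit, inP. split.
  - intros i j _. unfold ind. destruct (_ <? _)%nat; lra.
  - unfold inP. intros i j i' j' I I' Li Lj.
    pose proof (height_lip a b H (m + (a + b) - i') (m + (a + b) - i) HH ltac:(lia)).
    pose proof (height_lip a b H (m + b - j') (m + b - j) HH ltac:(lia)).
    unfold ind.
    destruct (Nat.ltb_spec (H (m + (a + b) - i)%nat) (j + H (m + b - j)%nat));
    destruct (Nat.ltb_spec (H (m + (a + b) - i')%nat) (j' + H (m + b - j')%nat));
      lra || lia.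
Qed.

(** The disjuncts are the defining inequalities at $(i-1,j)$ and $(i,j-1)$. If such a point falls
    outside $P$, its inequality fails by [B1] or [B2], in accordance with the value 0 at $\hat0$. *)
Lemma lowmax_orbit (a b : nat) (H : nat -> nat) (m i j : nat) :
  height a b H -> inP a b i j ->
  lowmax (orbit a b H m) i j =
  ind ((H (S m + (a + b) - i) <? j + H (m + b - j))%nat ||
       (S (H (m + (a + b) - i)) <? j + H (S m + b - j))%nat).
Proof.
  intros HH I. unfold inP in I.
  assert (E1 : (m + (a + b) - (i - 1) = S m + (a + b) - i)%nat) by lia.
  assert (E2 : (m + b - (j - 1) = S m + b - j)%nat) by lia.
  assert (B1 : i = 1%nat -> (j + H (m + b - j) <= H (S m + (a + b) - i))%nat).
  { intros ->. replace (S m + (a + b) - 1)%nat with (m + (a + b))%nat by lia.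
    rewrite (proj2 HH m).
    pose proof (height_lip a b H m (m + b - j) HH ltac:(lia)). lia. }
  assert (B2 : (H (S m + b - j) <= H (m + (a + b) - i))%nat)
    by (apply (height_lip a b H); [easy|lia]).
  clear HH. unfold lowmax, orbit, ind.
  destruct (Nat.eqb_spec i 1) as [->|Ei]; destruct (Nat.eqb_spec j 1) as [->|Ej];
    rewrite ?E1, ?E2; clear E1 E2;
    repeat match goal with
    | |- context [(?x <? ?y)%nat] => destruct (Nat.ltb_spec x y); cbn [orb]
    end; try reflexivity; try (exfalso; lia);
    unfold Rmax; destruct (Rle_dec _ _); lra.
Qed.

(** Dual to the lower covers: outside $P$ the inequality at $(i+1,j)$ or $(i,j+1)$ holds
    automatically, in accordance with the value 1 at $\hat1$. *)
Lemma upmin_orbit (a b : nat) (H : nat -> nat) (m i j : nat) :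
  height a b H -> inP a b i j ->
  upmin a b (orbit a b H (S m)) i j =
  ind ((H (m + (a + b) - i) <? j + H (S m + b - j))%nat &&
       (H (S m + (a + b) - i) <? S j + H (m + b - j))%nat).
Proof.
  intros HH I. unfold inP in I.
  assert (E1 : (S m + (a + b) - (i + 1) = m + (a + b) - i)%nat) by lia.
  assert (E2 : (S m + b - (j + 1) = m + b - j)%nat) by lia.
  assert (B1 : i = a -> (H (m + (a + b) - i) < j + H (S m + b - j))%nat).
  { intros ->. replace (m + (a + b) - a)%nat with (m + b)%nat by lia.
    pose proof (height_lip a b H (S m + b - j) (m + b) HH ltac:(lia)). lia. }
  assert (B2 : j = b -> (H (S m + (a + b) - i) < S j + H (m + b - j))%nat).
  { intros ->. replace (m + b - b)%nat with m by lia.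
    pose proof (proj2 HH m).
    pose proof (height_lip a b H (S m + (a + b) - i) (m + (a + b)) HH ltac:(lia)).
    lia. }
  clear HH. unfold upmin, orbit, ind.
  destruct (Nat.eqb_spec i a) as [->|Ei]; destruct (Nat.eqb_spec j b) as [->|Ej];
    rewrite ?E1, ?E2; clear E1 E2;
    repeat match goal with
    | |- context [(?x <? ?y)%nat] => destruct (Nat.ltb_spec x y); cbn [andb]
    end; try reflexivity; try (exfalso; lia);
    unfold Rmin; destruct (Rle_dec _ _); lra.
Qed.

(** All four terms depend on the same four heights, those at the two window ends before and after a
    unit time step. Each end gains 0 or 1, which leaves a finite check. *)
Lemma rowmotion_orbit (a b : nat) (H : nat -> nat) (m i j : nat) :
  height a b H -> inP a b i j ->
  orbit a b H (S m) i j =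
  lowmax (orbit a b H m) i j + upmin a b (orbit a b H (S m)) i j
  - orbit a b H m i j.
Proof.
  intros HH I. rewrite lowmax_orbit, upmin_orbit by easy.
  unfold inP in I. destruct HH as [St _].
  pose proof (St (m + (a + b) - i)%nat) as S1.
  pose proof (St (m + b - j)%nat) as S2.
  replace (S (m + (a + b) - i)) with (S m + (a + b) - i)%nat in S1 by lia.
  replace (S (m + b - j)) with (S m + b - j)%nat in S2 by lia.
  unfold orbit, ind.
  repeat match goal with
  | |- context [(?x <? ?y)%nat] => destruct (Nat.ltb_spec x y); cbn [andb orb]
  end; try lia; lra.
Qed.

Lemma iter_orbit (a b : nat) (H : nat -> nat) (m i j : nat) :
  height a b H -> inP a b i j ->
  Nat.iter m (rowmotion a b) (orbit a b H 0) i j = orbit a b H m i j.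
Proof.
  intros HH. revert i j. induction m as [|m IH]; intros i j I; [easy|].
  cbn [Nat.iter nat_rect].
  apply (rowmotion_unique a b (Nat.iter m (rowmotion a b) (orbit a b H 0))
           (orbit a b H (S m))); [|easy].
  clear i j I. intros i j I.
  rewrite (lowmax_ext a b _ _ IH) by easy. rewrite IH by easy.
  now apply rowmotion_orbit.
Qed.

(** * Orbit sums as window counts *)

Definition windows (a b : nat) (H : nat -> nat) (i j : nat) : R :=
  sumL (map (fun u => ind (H (u + (a + j - i)) <? j + H u)%nat) (seq 0 (a + b))).

Lemma windows_orbit (a b : nat) (H : nat -> nat) (i j : nat) :
  height a b H -> inP a b i j ->
  sumL (map (fun m => orbit a b H m i j) (seq 0 (a + b))) = windows a b H i j.
Proof.
  intros HH I. unfold windows.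
  (* At time [m] the window starts at [m + (b - j)]; over a full period this shift does not change
     the sum. *)
  rewrite <- (sumL_seq_shift (fun u => ind (H (u + (a + j - i)) <? j + H u)%nat) _ (b - j)).
  - apply sumL_map_ext. intros m _. cbv beta. unfold orbit, inP in *.
    replace (m + (b - j) + (a + j - i))%nat with (m + (a + b) - i)%nat by lia.
    now replace (m + (b - j))%nat with (m + b - j)%nat by lia.
  - intros u. f_equal.
    replace (u + (a + b) + (a + j - i))%nat with (u + (a + j - i) + (a + b))%nat by lia.
    rewrite !(proj2 HH).
    destruct (Nat.ltb_spec (H (u + (a + j - i))%nat) (j + H u));
      [apply Nat.ltb_lt|apply Nat.ltb_ge]; lia.
Qed.

Lemma homomesic_windows (a b : nat) (c : nat -> nat -> R) :
  (1 <= a)%nat -> homomesic_rowmotion a b (linF a b c) ->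
  exists K, forall H, height a b H ->
    sumP a b (fun i j => c i j * windows a b H i j) = K.
Proof.
  intros Ha [K HK]. exists (INR (a + b) * K). intros H HH.
  rewrite <- (HK (orbit a b H 0)) by now apply orbit_in_OP.
  rewrite <- Rmult_assoc, Rinv_r, Rmult_1_l by (apply not_0_INR; lia).
  unfold linF, sumP. rewrite sumL_map_swap. apply sumL_map_ext.
  intros [i j] I. cbn. apply in_elemsP in I.
  rewrite <- windows_orbit, <- sumL_map_scal by easy.
  apply sumL_map_ext. intros m _. now rewrite iter_orbit.
Qed.

(** * Words with two independent transpositions *)

(* For [x = y = 0], one period is [0 1^h 0^(q-h) 1^(b-h) 0 ...]; setting [x = 1]
   swaps the letters at positions 0 and 1, and [y = 1] those at [q] and [q+1]. *)
Definition core (b h q x y t : nat) : nat :=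
  (Nat.min (t - 1) h + Nat.min (t - (q + 1)) (b - h) +
   (if t =? 1 then x else 0) + (if t =? q + 1 then y else 0))%nat.

Definition word_height (a b h q x y t : nat) : nat :=
  (b * (t / (a + b)) + core b h q x y (t mod (a + b)))%nat.

Section Word.

Variables a b i h : nat.
Hypothesis Hi : (1 <= i < a)%nat.
Hypothesis Hh : (1 <= h < b)%nat.
(** The window length belonging to the file of $(i,h)$ and $(i+1,h+1)$. The bounds on [i] and [h]
    make both swaps exchange a 0 with a 1 at disjoint places. *)
Let q := (a + h - i)%nat.

Lemma word_height_height (x y : nat) :
  (x <= 1)%nat -> (y <= 1)%nat -> height a b (word_height a b h q x y).
Proof.
  intros Hx Hy. unfold word_height. split.
  - intros t.
    pose proof (Nat.div_mod_eq t (a + b)) as D.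
    pose proof (Nat.mod_upper_bound t (a + b) ltac:(lia)) as U.
    set (d := (t / (a + b))%nat) in *. set (r := (t mod (a + b))%nat) in *.
    (* In the first case the step crosses into the next period: [core] restarts at 0 and the
       quotient contributes another $b$. *)
    destruct (Nat.eq_dec (S r) (a + b)) as [E|E].
    + assert (D1 : (S t / (a + b) = S d)%nat)
        by (symmetry; apply (Nat.div_unique _ _ _ 0); nia).
      assert (D2 : (S t mod (a + b) = 0)%nat)
        by (symmetry; apply (Nat.mod_unique _ _ (S d)); nia).
      rewrite D1, D2, Nat.mul_succ_r. clear D D1 D2. unfold core. subst q.
      destruct (Nat.eqb_spec r 1), (Nat.eqb_spec r (a + h - i + 1)),
        (Nat.eqb_spec 0 1), (Nat.eqb_spec 0 (a + h - i + 1)); lia.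
    + assert (D1 : (S t / (a + b) = d)%nat)
        by (symmetry; apply (Nat.div_unique _ _ _ (S r)); nia).
      assert (D2 : (S t mod (a + b) = S r)%nat)
        by (symmetry; apply (Nat.mod_unique _ _ d); nia).
      rewrite D1, D2. clear D D1 D2. unfold core. subst q.
      destruct (Nat.eqb_spec r 1), (Nat.eqb_spec r (a + h - i + 1)),
        (Nat.eqb_spec (S r) 1), (Nat.eqb_spec (S r) (a + h - i + 1)); lia.
  - intros t.
    replace (t + (a + b))%nat with (t + 1 * (a + b))%nat by lia.
    rewrite Nat.div_add, Nat.Div0.mod_add by lia. lia.
Qed.

(** Windows start in the first period and are shorter than $n$, so explicit heights on two periods
    suffice. *)
Lemma word_height_low (x y t : nat) :
  (t < a + b)%nat -> word_height a b h q x y t = core b h q x y t.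
Proof.
  intros L. unfold word_height. rewrite Nat.div_small, Nat.mod_small; lia.
Qed.

Lemma word_height_high (x y t : nat) :
  (a + b <= t < a + b + (a + b))%nat ->
  word_height a b h q x y t = (b + core b h q x y (t - (a + b)))%nat.
Proof.
  intros L. unfold word_height.
  rewrite <- (Nat.div_unique t (a + b) 1 (t - (a + b))) by lia.
  rewrite <- (Nat.mod_unique t (a + b) 1 (t - (a + b))) by lia. lia.
Qed.

Let test (k j x y u : nat) : R :=
  ind (word_height a b h q x y (u + k) <? j + word_height a b h q x y u)%nat.

Definition is (m n : nat) : R := if (m =? n)%nat then 1 else 0.

(** The height depends on [x] only at places congruent to 1 modulo $n$, and on [y] only at those
    congruent to $q+1$. The mixed difference vanishes unless the window joins one of each kind: from
    1 to $q+1$, with $h+y-x$ ones, or from $q+1$ to $n+1$, with $b-h+x-y$ ones. Second differences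
    of the threshold indicator then give the two deltas in [j]. *)
Lemma test_second_difference (k j u : nat) :
  (1 <= k < a + b)%nat -> (u < a + b)%nat ->
  test k j 0 0 u - test k j 1 0 u - test k j 0 1 u + test k j 1 1 u =
  is u 1 * (is k q * (is j (h + 1) - is j h)) +
  is u (q + 1) * (is k (a + b - q) * (is j (b - h + 1) - is j (b - h))).
Proof.
  intros Hk Hu.
  assert (X : forall v, (v < a + b + (a + b))%nat -> v <> 1%nat -> v <> (a + b + 1)%nat ->
    forall y, word_height a b h q 1 y v = word_height a b h q 0 y v).
  { intros v Hv N1 N2 y. destruct (le_lt_dec (a + b) v) as [L|L].
    - rewrite !word_height_high by lia. unfold core.
      destruct (Nat.eqb_spec (v - (a + b)) 1); lia.
    - rewrite !word_height_low by lia. unfold core.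
      destruct (Nat.eqb_spec v 1); lia. }
  assert (Y : forall v, (v < a + b + (a + b))%nat -> v <> (q + 1)%nat ->
    v <> (a + b + (q + 1))%nat ->
    forall x, word_height a b h q x 1 v = word_height a b h q x 0 v).
  { intros v Hv N1 N2 x. destruct (le_lt_dec (a + b) v) as [L|L].
    - rewrite !word_height_high by lia. unfold core.
      destruct (Nat.eqb_spec (v - (a + b)) (q + 1)); lia.
    - rewrite !word_height_low by lia. unfold core.
      destruct (Nat.eqb_spec v (q + 1)); lia. }
  assert (W1 : forall x y, word_height a b h q x y 1 = x).
  { intros x y. rewrite word_height_low by lia. unfold core. subst q.
    destruct (Nat.eqb_spec 1 1), (Nat.eqb_spec 1 (a + h - i + 1)); lia. }
  assert (Wq : forall x y, word_height a b h q x y (q + 1) = (h + y)%nat).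
  { intros x y. rewrite word_height_low by lia. unfold core. subst q.
    destruct (Nat.eqb_spec (a + h - i + 1) 1),
      (Nat.eqb_spec (a + h - i + 1) (a + h - i + 1)); lia. }
  assert (Wn : forall x y, word_height a b h q x y (a + b + 1) = (b + x)%nat).
  { intros x y. rewrite word_height_high by lia.
    replace (a + b + 1 - (a + b))%nat with 1%nat by lia. unfold core. subst q.
    destruct (Nat.eqb_spec 1 1), (Nat.eqb_spec 1 (a + h - i + 1)); lia. }
  assert (Q : (2 <= q /\ q + 2 <= a + b)%nat) by (subst q; lia).
  unfold test, is.
  destruct (Nat.eqb_spec u 1) as [U1|U1]; destruct (Nat.eqb_spec u (q + 1)) as [Uq|Uq];
    [lia| | |].
  - subst u. destruct (Nat.eqb_spec k q) as [->|K].
    + rewrite (Nat.add_comm 1 q), !W1, !Wq. unfold ind.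
      destruct (Nat.eqb_spec j (h + 1)), (Nat.eqb_spec j h);
      repeat match goal with
      | |- context [(?s <? ?t)%nat] => destruct (Nat.ltb_spec s t)
      end; try lra; exfalso; lia.
    + rewrite !Y by lia. lra.
  - subst u. destruct (Nat.eqb_spec k (a + b - q)) as [->|K].
    + replace (q + 1 + (a + b - q))%nat with (a + b + 1)%nat by lia.
      rewrite !Wn, !Wq. unfold ind.
      destruct (Nat.eqb_spec j (b - h + 1)), (Nat.eqb_spec j (b - h));
      repeat match goal with
      | |- context [(?s <? ?t)%nat] => destruct (Nat.ltb_spec s t)
      end; try lra; exfalso; lia.
    + rewrite !X by lia. lra.
  (* The start depends on neither swap, and the end on at most one of them, so the terms cancel in
     pairs. *)
  - destruct (Nat.eq_dec (u + k) 1) as [E|E];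
      [|destruct (Nat.eq_dec (u + k) (a + b + 1)) as [E'|E']].
    + rewrite !Y by lia. lra.
    + rewrite !Y by lia. lra.
    + rewrite !X by lia. lra.
Qed.

Lemma sumL_is (m : nat) (r : R) :
  (m < a + b)%nat -> sumL (map (fun u => is u m * r) (seq 0 (a + b))) = r.
Proof.
  intros L. rewrite (sumL_map_single _ _ m).
  - unfold is. rewrite Nat.eqb_refl. lra.
  - apply seq_NoDup.
  - apply in_seq. lia.
  - intros y _ N. unfold is. destruct (Nat.eqb_spec y m); [easy|lra].
Qed.

Lemma windows_second_difference (i' j : nat) :
  inP a b i' j ->
  windows a b (word_height a b h q 0 0) i' j
  - windows a b (word_height a b h q 1 0) i' j
  - windows a b (word_height a b h q 0 1) i' j
  + windows a b (word_height a b h q 1 1) i' j =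
  single (i + 1) (h + 1) i' j - single i h i' j
  + (single (a + 1 - i) (b + 1 - h) i' j
     - single (a + 1 - (i + 1)) (b + 1 - (h + 1)) i' j).
Proof.
  intros I. unfold inP in I.
  set (k := (a + j - i')%nat).
  transitivity (sumL (map (fun u =>
    test k j 0 0 u - test k j 1 0 u - test k j 0 1 u + test k j 1 1 u)
    (seq 0 (a + b)))).
  { unfold windows. fold k. generalize (seq 0 (a + b)) as l.
    induction l as [|u l IH]; [cbn; lra|]. rewrite !sumL_map_cons, <- IH.
    unfold test. lra. }
  rewrite (sumL_map_ext _ (fun u => is u 1 * (is k q * (is j (h + 1) - is j h)) +
    is u (q + 1) * (is k (a + b - q) * (is j (b - h + 1) - is j (b - h))))).
  2:{ intros u Hu. apply in_seq in Hu. apply test_second_difference; lia. }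
  rewrite sumL_map_plus, !sumL_is by lia.
  (* The window length and the second coordinate determine a point of $P$. Length $q$ yields $(i,h)$
     and $(i+1,h+1)$; length $n-q$ yields their reflections. *)
  assert (E : forall m x y, (m + x = a + y)%nat -> is k m * is j y = single x y i' j).
  { intros m x y E. unfold is, single, k.
    destruct (Nat.eqb_spec (a + j - i') m), (Nat.eqb_spec j y), (Nat.eqb_spec i' x);
      cbn; try lra; exfalso; lia. }
  rewrite !Rmult_minus_distr_l.
  rewrite (E q (i + 1) (h + 1))%nat by lia.
  rewrite (E q i h)%nat by lia.
  rewrite (E (a + b - q) (a + 1 - i) (b - h + 1))%nat by lia.
  rewrite (E (a + b - q) (a + 1 - (i + 1)) (b - h))%nat by lia.
  replace (b - h + 1)%nat with (b + 1 - h)%nat by lia.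
  now replace (b + 1 - (h + 1))%nat with (b - h)%nat by lia.
Qed.

End Word.

(** * The antisymmetric part of the coefficients and the decomposition *)

Definition skew (a b : nat) (c : nat -> nat -> R) (i j : nat) : R :=
  c i j - c (a + 1 - i)%nat (b + 1 - j)%nat.

(** The four words with $h=j$ give the same weighted total [K], so pairing [c] with the mixed
    difference gives $K-K-K+K=0$. What remains is a signed sum of [c] at the two points and their
    reflections. *)
Lemma skew_step (a b : nat) (c : nat -> nat -> R) (i j : nat) :
  homomesic_rowmotion a b (linF a b c) -> (1 <= i < a)%nat -> (1 <= j < b)%nat ->
  skew a b c (i + 1) (j + 1) = skew a b c i j.
Proof.
  intros Hc Hi Hj. apply homomesic_windows in Hc as [K HK]; [|lia].
  assert (Z : sumP a b (fun i' j' => c i' j' *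
     (single (i + 1) (j + 1) i' j' - single i j i' j'
  + (single (a + 1 - i) (b + 1 - j) i' j'
     - single (a + 1 - (i + 1)) (b + 1 - (j + 1)) i' j'))) = 0).
  { rewrite (sumP_ext _ _ _ (fun i' j' => c i' j' *
      (windows a b (word_height a b j (a + j - i) 0 0) i' j'
      - windows a b (word_height a b j (a + j - i) 1 0) i' j'
      - windows a b (word_height a b j (a + j - i) 0 1) i' j'
      + windows a b (word_height a b j (a + j - i) 1 1) i' j'))).
    2:{ intros i' j' I. now rewrite windows_second_difference. }
    pose proof (fun x y Hx Hy => HK _ (word_height_height a b i j Hi Hj x y Hx Hy)) as S.
    pose proof (S 0 0 ltac:(lia) ltac:(lia))%nat as S00.
    pose proof (S 1 0 ltac:(lia) ltac:(lia))%nat as S10.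
    pose proof (S 0 1 ltac:(lia) ltac:(lia))%nat as S01.
    pose proof (S 1 1 ltac:(lia) ltac:(lia))%nat as S11.
    transitivity (K - K - K + K); [|lra].
    rewrite <- S00 at 1. rewrite <- S10 at 1. rewrite <- S01 at 1. rewrite <- S11 at 1.
    unfold sumP. generalize (elemsP a b) as l.
    induction l as [|p l IH]; [cbn; lra|]. rewrite !sumL_map_cons, IH. lra. }
  assert (L : forall x1 y1 x2 y2 x3 y3 x4 y4 : nat, sumP a b (fun i' j' => c i' j' *
     (single x1 y1 i' j' - single x2 y2 i' j'
      + (single x3 y3 i' j' - single x4 y4 i' j'))) =
     sumP a b (fun i' j' => c i' j' * single x1 y1 i' j')
     - sumP a b (fun i' j' => c i' j' * single x2 y2 i' j')
     + (sumP a b (fun i' j' => c i' j' * single x3 y3 i' j')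
     - sumP a b (fun i' j' => c i' j' * single x4 y4 i' j'))).
  { intros. unfold sumP. generalize (elemsP a b) as l.
    induction l as [|p l IH]; [cbn; lra|]. rewrite !sumL_map_cons, IH. lra. }
  rewrite L, !sumP_single in Z by (unfold inP; lia).
  unfold skew. lra.
Qed.

Lemma skew_file (a b : nat) (c : nat -> nat -> R) (i j t : nat) :
  homomesic_rowmotion a b (linF a b c) -> inP a b i j -> inP a b (i + t) (j + t) ->
  skew a b c (i + t) (j + t) = skew a b c i j.
Proof.
  intros Hc I. unfold inP in *. induction t as [|t IH]; intros I'.
  - now rewrite !Nat.add_0_r.
  - rewrite <- IH by lia.
    replace (i + S t)%nat with (i + t + 1)%nat by lia.
    replace (j + S t)%nat with (j + t + 1)%nat by lia.
    apply skew_step; [easy|lia..].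
Qed.

(** After exchanging the sums, each point meets exactly one file, $k=j+a-i$, which lies between 1
    and $n-1$. *)
Lemma sum_files (a b : nat) (e : nat -> R) (f : lab) :
  sumL (map (fun k => e k * Fk a b k f) (seq 1 (a + b - 1))) =
  sumP a b (fun i j => e (j + a - i)%nat * f i j).
Proof.
  transitivity (sumL (map (fun k => sumL (map (fun p => e k *
    (if (snd p + a =? k + fst p)%nat then f (fst p) (snd p) else 0)) (elemsP a b)))
    (seq 1 (a + b - 1)))).
  { apply sumL_map_ext. intros k _. now rewrite sumL_map_scal. }
  rewrite sumL_map_swap. unfold sumP. apply sumL_map_ext. intros [i j] I.
  apply in_elemsP in I. unfold inP in I. cbn.
  rewrite (sumL_map_single _ _ (j + a - i)%nat).
  - now replace (j + a - i + i)%nat with (j + a)%nat by lia; rewrite Nat.eqb_refl.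
  - apply seq_NoDup.
  - apply in_seq. lia.
  - intros k _ N. destruct (Nat.eqb_spec (j + a) (k + i)); [lia|lra].
Qed.

Theorem theorem10 (a b : nat) (ha : (1 <= a)%nat) (hb : (1 <= b)%nat)
  (c : nat -> nat -> R) :
  homomesic_rowmotion a b (linF a b c) ->
  exists (d : nat -> nat -> R) (e : nat -> R),
    forall f, in_OP a b f ->
      linF a b c f =
        sumP a b (fun i j => d i j * Fij a b i j f)
        + sumL (map (fun k => e k * Fk a b k f) (seq 1 (a + b - 1))).
Proof.
  intros Hc.
  (* The truncated subtractions make [(1 + (a - k), 1 + (k - a))] the minimum of
     the file [k]. *)
  exists (fun i j => c i j / 2),
    (fun k => skew a b c (1 + (a - k)) (1 + (k - a)) / 2).
  intros f _. rewrite sum_files.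
  (* Reflecting the second summand of [Fij] shows that the weights [c / 2] produce the symmetric
     part of [c]; the files must supply [skew / 2]. *)
  assert (E : sumP a b (fun i j => c i j / 2 * Fij a b i j f) =
    sumP a b (fun i j => c i j / 2 * f i j) +
    sumP a b (fun i j => c (a + 1 - i)%nat (b + 1 - j)%nat / 2 * f i j)).
  { rewrite <- (sumP_reflect a b (fun i j => c (a + 1 - i)%nat _ / 2 * f i j)).
    rewrite <- sumP_plus. apply sumP_ext. intros i j I.
    unfold inP in I. unfold Fij.
    replace (a + 1 - (a + 1 - i))%nat with i by lia.
    replace (b + 1 - (b + 1 - j))%nat with j by lia. lra. }
  rewrite E. unfold linF. rewrite <- !sumP_plus.
  apply sumP_ext. intros i j I.
  (* The number of diagonal steps from the minimum of the file up to $(i,j)$. *)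
  set (t := Nat.min (i - 1) (j - 1)).
  pose proof (skew_file a b c (i - t) (j - t) t Hc) as S. unfold inP in *.
  replace (i - t + t)%nat with i in S by lia.
  replace (j - t + t)%nat with j in S by lia.
  replace (1 + (a - (j + a - i)))%nat with (i - t)%nat by lia.
  replace (1 + (j + a - i - a))%nat with (j - t)%nat by lia.
  rewrite <- S by lia. unfold skew. lra.
Qed.
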